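(* There exist absolute constants $c>0$ and $C>0$ such that for every integer $n\ge 3$ there is an integer $k$ with $c\,\frac{\log n}{\log\log n}\le k\le n$ for which the following holds. Let $N$ be a positive integer and suppose that each of the numbers $1,2,\ldots,N$ has one of $n$ colours assigned to it, in such a way that there are no monochromatic solutions to the equation $$x_1+x_2+\cdots+x_{12}=y_1+y_2+\cdots+y_{9}.$$ Then $N\le C\sqrt{(n-k)!}$.
   Context: A monochromatic solution of an equation, with respect to a colouring of $\{1,\ldots,N\}$, is an assignment of values in $\{1,\ldots,N\}$, all of the same colour, to the variables such that the equation holds; the values of the variables need not be distinct. Here $\log$ denotes the natural logarithm. *)

(* Defs.v *)
From HB Require Import structures.
From mathcomp Require Import all_boot all_order all_algebra.

Set Implicit Arguments.
Unset Strict Implicit.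
Unset Printing Implicit Defensive.

(* A colouring of {1, ..., N} with n colours is represented by a function
   chi : nat -> 'I_n of which only the values on {1, ..., N} are used.  The
   variables are indexed from 0, and they may take equal values. *)
Definition monochromatic_solution (n N p q : nat) (chi : nat -> 'I_n)
    (x : 'I_p -> nat) (y : 'I_q -> nat) : Prop :=
  [/\ (forall i, 1 <= x i <= N),
      (forall j, 1 <= y j <= N),
      (exists a : 'I_n,
         (forall i, chi (x i) = a) /\ (forall j, chi (y j) = a))
    & \sum_(i < p) x i = \sum_(j < q) y j].

(* Main.v *)
(** Join two points of [0, N] by an edge of the colour of their distance.  A
    closed walk with four steps of one sign and three of the other, repeated
    three times, is a solution of the equation, so for every colour c and
    i <= 3 the points reached from v by walks of i steps of colour c with a
    fixed sign pattern form a c-independent set.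

    Give a point seeing s colours inside the current vertex set V the weight
    prod_(s < j <= n) rho j, where rho j - 1 = cbrt16 j is least with cube >=
    16 j. If M is c-independent then deleting its c-neighbours makes every
    point of M lose the colour c and multiplies its weight by rho at least.
    Some M among the sets above, taken from a point v with the fewest colours,
    has a neighbourhood light enough for the total weight not to drop:
    otherwise, c being the colour carrying most weight around v, the weights
    of the successive sets would grow until the last neighbourhood outweighs
    V. Iterating down to a single point gives N < prod_(j <= n) rho j = O(1)^n
    (n!)^(1/3), which is far below the bound required, even with k about n/4.
    *)

Require Import Defs.
From HB Require Import structures.
From mathcomp Require Import all_boot all_order all_algebra.
From mathcomp Require Import all_classical all_reals all_analysis.
From mathcomp Require Import zify ring lra.
(* The names of finite set theory are shadowed by those of classical_sets. *)
From mathcomp Require Import fintype finset.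

Set Implicit Arguments.
Unset Strict Implicit.
Unset Printing Implicit Defensive.

Import Order.TTheory GRing.Theory Num.Theory.

(** * Rounded cube roots and the weights built from them *)

Lemma cbrt_ex j : exists q, 16 * j <= q ^ 3.
Proof. by exists (16 * j); nia. Qed.

Definition cbrt16 j := ex_minn (cbrt_ex j).

Lemma cbrt16_ge j : 16 * j <= cbrt16 j ^ 3.
Proof. by rewrite /cbrt16; case: ex_minnP. Qed.

Lemma cbrt16_min j q : 16 * j <= q ^ 3 -> cbrt16 j <= q.
Proof. by rewrite /cbrt16; case: ex_minnP => m _ h /h. Qed.

Lemma cbrt16_homo i j : i <= j -> cbrt16 i <= cbrt16 j.
Proof. by move=> ij; apply: cbrt16_min; have := cbrt16_ge j; lia. Qed.

Lemma cbrt16_gt0 j : 0 < j -> 0 < cbrt16 j.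
Proof. by have := cbrt16_ge j; case: (cbrt16 j) => // ; lia. Qed.

Definition weight n s := \prod_(s <= j < n) (cbrt16 j.+1).+1.

Lemma weight_gt0 n s : 0 < weight n s.
Proof. by apply: prodn_gt0. Qed.

Lemma weight_rec n s : s < n -> weight n s = (cbrt16 s.+1).+1 * weight n s.+1.
Proof. by move=> sn; rewrite /weight big_ltn. Qed.

Lemma weight_anti n s t : s <= t -> t <= n -> weight n t <= weight n s.
Proof.
move=> st tn; rewrite /weight (@big_cat_nat _ _ _ t s n) //=.
by rewrite leq_pmull // prodn_gt0.
Qed.

(** * The distance graph on [0, N] and its monochromatic walks *)

Section Colouring.
Variables (n N : nat) (chi : nat -> 'I_n).
Hypothesis nosol : ~ (exists (x : 'I_12 -> nat) (y : 'I_9 -> nat),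
  monochromatic_solution N chi x y).

Local Notation vertex := 'I_N.+1.
Implicit Types (V M : {set vertex}) (v x y : vertex) (c : 'I_n).

Definition forward c x y := (x < y) && (chi (y - x) == c).
Definition arc (b : bool) c x y := if b then forward c x y else forward c y x.
Definition adjacent c x y := arc true c x y || arc false c x y.

Definition succ V b c M := [set y in V | [exists x in M, arc b c x y]].
Definition nbhd V c M := [set y in V | [exists x in M, adjacent c x y]].
Definition colours V v := [set c | nbhd V c [set v] != set0].
Definition wt V v := weight n #|colours V v|.
Definition mass V M := \sum_(v in M) wt V v.

Definition coloured c (s : seq nat) := all (fun d => (0 < d <= N) && (chi d == c)) s.

(* All points of [M] are reached from a common point by walks of [i] steps of
   colour [c] with the same pattern of signs. *)
Definition linked i c M := forall x y, x \in M -> y \in M ->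
  exists a b : seq nat, [/\ size a = i, size b = i, coloured c a, coloured c b
    & x + sumn a = y + sumn b].

Lemma adjacent_sym c x y : adjacent c x y = adjacent c y x.
Proof. by rewrite /adjacent /= orbC. Qed.

Lemma adjacentxx c x : adjacent c x x = false.
Proof. by rewrite /adjacent /= /forward ltnn. Qed.

Lemma linked1 c v : linked 0 c [set v].
Proof. by move=> x y /set1P -> /set1P ->; exists [::], [::]. Qed.

Lemma linked_succ V b i c M : linked i c M -> linked i.+1 c (succ V b c M).
Proof.
move=> L x y; rewrite !inE => /andP[_ /exists_inP[x' x'M ax]].
move=> /andP[_ /exists_inP[y' y'M ay]].
have [s [t [sa sb ca cb e]]] := L _ _ x'M y'M.
have ltx := ltn_ord x; have lty := ltn_ord y.
have ltx' := ltn_ord x'; have lty' := ltn_ord y'.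
case: b ax ay => /= /andP[lx cx] /andP[ly cy].
  (* After forward arcs the new steps go crosswise: the step to [y] joins the list of [x] and
     conversely, which keeps the balance of sums free of subtraction. *)
  exists (y - y' :: s), (x - x' :: t); rewrite /= sa sb ca cb cx cy !andbT.
  by split=> //; lia.
exists (x' - x :: s), (y' - y :: t); rewrite /= sa sb ca cb cx cy !andbT.
by split=> //; lia.
Qed.

(** Cycling through [a] and [b], with every entry used three times, fills the 12 variables on the
    left and the 9 on the right. *)
Lemma no_closed_walk c (a b : seq nat) : size a = 4 -> size b = 3 ->
  coloured c a -> coloured c b -> sumn a <> sumn b.
Proof.
move=> sa sb /allP ca /allP cb e; apply: nosol.
have xa (i : 'I_12) : nth 0 a (i %% 4) \in a by rewrite mem_nth // sa ltn_mod.
have yb (i : 'I_9) : nth 0 b (i %% 3) \in b by rewrite mem_nth // sb ltn_mod.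
exists (fun i => nth 0 a (i %% 4)), (fun j => nth 0 b (j %% 3)); split.
- by move=> i; have /andP[] := ca _ (xa i).
- by move=> j; have /andP[] := cb _ (yb j).
- by exists c; split=> i; apply/eqP; [case/andP: (ca _ (xa i)) | case/andP: (cb _ (yb i))].
- case: a b sa sb e {ca cb xa yb} => [|a0 [|a1 [|a2 [|a3 []]]]] //.
  case=> [|b0 [|b1 [|b2 []]]] //= _ _ e.
  by rewrite !big_ord_recl !big_ord0 /= /bump /=; lia.
Qed.

(** An edge of length [d] and colour [c] inside [M] would give [sumn a = d + sumn b] with lists of
    length [i]. Adding [3 - i] copies of [d] to both sides produces the forbidden lengths 4 and
    3. *)
Lemma linked_indep i c M x y : i <= 3 -> linked i c M ->
  x \in M -> y \in M -> ~~ adjacent c x y.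
Proof.
move=> i3 L; suff H u v : u \in M -> v \in M -> ~~ forward c u v.
  by move=> xM yM; rewrite negb_or /= !H.
move=> uM vM; apply/negP => /andP[lt /eqP cd].
have ltv := ltn_ord v.
have [a [b [sa sb ca cb e]]] := L _ _ uM vM.
have cp k : coloured c (nseq k (v - u)).
  by apply/allP => d /nseqP[-> _]; rewrite cd eqxx andbT; lia.
apply: (@no_closed_walk c (v - u :: nseq (3 - i) (v - u) ++ b)
                          (nseq (3 - i) (v - u) ++ a)) => /=.
- by rewrite size_cat size_nseq sb; lia.
- by rewrite size_cat size_nseq sa; lia.
- rewrite cd eqxx andbT; apply/andP; split; first by lia.
  by rewrite /coloured all_cat; apply/andP; split=> //; apply: cp.
- by rewrite /coloured all_cat; apply/andP; split=> //; apply: cp.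
- by rewrite !sumn_cat; lia.
Qed.

(** * Colours seen by a vertex, and the gain from deleting neighbours *)

Lemma coloursP V v c :
  reflect (exists2 y, y \in V & adjacent c v y) (c \in colours V v).
Proof.
rewrite inE; apply: (iffP (set0Pn _)) => [[y]|[y yV a]].
  by rewrite inE => /andP[yV /exists_inP[x /set1P -> a]]; exists y.
by exists y; rewrite inE yV; apply/exists_inP; exists v => //; rewrite inE.
Qed.

Lemma coloursS V V' v : V' \subset V -> colours V' v \subset colours V v.
Proof.
move=> sV; apply/subsetP => c /coloursP[y yV a]; apply/coloursP.
by exists y => //; apply: (subsetP sV).
Qed.

Lemma card_colours V v : #|colours V v| <= n.
Proof. by rewrite -[X in _ <= X]card_ord max_card. Qed.

Lemma wt_le V V' v : V' \subset V -> wt V v <= wt V' v.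
Proof.
by move=> sV; apply: weight_anti (card_colours V v); apply/subset_leq_card/coloursS.
Qed.

Lemma wt_drop V V' c v : V' \subset V -> c \in colours V v ->
  c \notin colours V' v -> (cbrt16 #|colours V v|).+1 * wt V v <= wt V' v.
Proof.
move=> sV cV cV'.
have lt : #|colours V' v| < #|colours V v|.
  by apply/proper_card/properP; split; [exact: coloursS | exists c].
rewrite /wt; case: #|colours V v| lt (card_colours V v) => // s lt sn.
by rewrite -weight_rec //; apply: weight_anti => //; lia.
Qed.

(** Independence keeps [M] among the survivors, where it loses [c]. The growth factor
    [(cbrt16 s).+1] leaves a surplus of [cbrt16 s] times the old weight, which pays for the deleted
    neighbourhood. *)
Lemma mass_delete V M c : M \subset V ->
    {in M &, forall x y, ~~ adjacent c x y} ->
    {in M, forall v, c \in colours V v} ->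
    mass V (nbhd V c M) <= \sum_(v in M) cbrt16 #|colours V v| * wt V v ->
  mass V V <= mass (V :\: nbhd V c M) (V :\: nbhd V c M).
Proof.
move=> MV ind act le; set X := nbhd V c M; set V' := V :\: X.
have sV : V' \subset V by apply: subsetDl.
have XV : X \subset V by apply/subsetP => y; rewrite inE => /andP[].
have MV' : M \subset V'.
  apply/subsetP => x xM; rewrite inE (subsetP MV _ xM) andbT.
  rewrite inE negb_and; apply/orP; right; apply/exists_inPn => y yM.
  exact: ind.
have splitM Y : mass Y V' = mass Y M + mass Y (V' :\: M).
  by rewrite /mass (big_setID M) /= (setIidPr MV').
rewrite {1}/mass (big_setID X) /= (setIidPr XV) -/(mass V X) -/V' -/(mass V V').
rewrite !splitM addnA leq_add //; last by apply: leq_sum => v _; apply: wt_le.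
apply: leq_trans (_ : \sum_(v in M) (cbrt16 #|colours V v|).+1 * wt V v <= _).
  under eq_bigr do rewrite mulSn.
  by rewrite big_split /= -/(mass V M) addnC leq_add2l.
apply: leq_sum => v vM; apply: (wt_drop sV (act _ vM)).
apply/coloursP => -[y]; rewrite inE => /andP[yX yV] a.
by move/negP: yX; apply; rewrite inE yV; apply/exists_inP; exists v.
Qed.

(** * Masses of neighbourhoods and the search for a deletable set *)

Lemma nbhd_succ V c M : nbhd V c M = succ V true c M :|: succ V false c M.
Proof.
apply/setP => y; rewrite !inE -andb_orr; congr (_ && _).
apply/exists_inP/orP => [[x xM /orP[]a]|[]/exists_inP[x xM a]].
- by left; apply/exists_inP; exists x.
- by right; apply/exists_inP; exists x.
- by exists x => //; rewrite /adjacent a.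
- by exists x => //; rewrite /adjacent a orbT.
Qed.

Lemma mass_subset V (A B : {set vertex}) : A \subset B -> mass V A <= mass V B.
Proof. by move=> AB; rewrite /mass [leqRHS](big_setID A) /= (setIidPr AB) leq_addr. Qed.

Lemma mass_succ V c M : exists b, mass V (nbhd V c M) <= 2 * mass V (succ V b c M).
Proof.
have le : mass V (nbhd V c M) <=
    mass V (succ V true c M) + mass V (succ V false c M).
  rewrite nbhd_succ {1}/mass (big_setID (succ V true c M)) /= setUK setDUl setDv set0U.
  by rewrite leq_add2l; apply/mass_subset/subsetDl.
have [h|h] := leqP (mass V (succ V true c M)) (mass V (succ V false c M)).
  by exists false; lia.
by exists true; lia.
Qed.

Lemma mass_colours V v : v \in V ->
  mass V (V :\ v) <= \sum_(c in colours V v) mass V (nbhd V c [set v]).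
Proof.
(* Truncated subtraction makes one summand zero, so the argument of [chi] is the distance of [y] and
   [v]. *)
move=> vV; pose f (y : vertex) := chi (y - v + (v - y)).
have adj y : y \in V :\ v -> adjacent (f y) v y.
  rewrite !inE -val_eqE neq_ltn => /andP[/orP[] lt _]; rewrite /adjacent /= /forward lt /f.
    by move: (ltnW lt); rewrite -subn_eq0 => /eqP ->; rewrite eqxx orbT.
  by move: (ltnW lt); rewrite -subn_eq0 => /eqP ->; rewrite addn0 eqxx.
rewrite {1}/mass (partition_big f (mem (colours V v))) /=; last first.
  move=> y yV; apply/coloursP; exists y; last exact: adj.
  by move: yV; rewrite inE => /andP[].
apply: leq_sum => c _.
rewrite [leqRHS](bigID (fun y => y \in [set y in V :\ v | f y == c])) /=.
apply: leq_trans (leq_addr _ _); apply/eq_leq/eq_bigl => y.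
apply/idP/andP => [H|[_]]; last by rewrite inE.
split; last by rewrite inE.
move: H => /andP[yV /eqP <-]; rewrite inE; apply/andP; split.
  by move: yV; rewrite inE => /andP[].
by apply/exists_inP; exists v; rewrite ?inE ?adj.
Qed.

Lemma mass_popular V v : v \in V -> 0 < mass V (V :\ v) ->
  exists2 c, c \in colours V v
    & mass V (V :\ v) <= #|colours V v| * mass V (nbhd V c [set v]).
Proof.
move=> vV; set m := mass V _ => m0; set s := #|_|.
have := mass_colours vV; rewrite -/m => le.
have [/exists_inP //|/exists_inPn H] := boolP [exists c in colours V v,
  m <= s * mass V (nbhd V c [set v])].
have: \sum_(c in colours V v) s * mass V (nbhd V c [set v]) <=
    \sum_(c in colours V v) m.-1.
  by apply: leq_sum => c /H; lia.
rewrite sum_nat_const -/s -big_distrr /=.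
have s0 : 0 < s.
  rewrite card_gt0; apply: contraTneq (leq_trans m0 le) => ->.
  by rewrite big_set0.
by rewrite leq_pmul2l // => le'; have := leq_trans le le'; lia.
Qed.

Lemma deletable V : 1 < #|V| ->
  exists c M, [/\ M \subset V, M != set0, {in M &, forall x y, ~~ adjacent c x y},
    {in M, forall v, c \in colours V v}
    & mass V (nbhd V c M) <= \sum_(v in M) cbrt16 #|colours V v| * wt V v].
Proof.
move=> V1; have /set0Pn[v0 v0V] : V != set0 by rewrite -card_gt0; lia.
(* Minimality makes [r] a lower bound for the factor [cbrt16] at every vertex of [V]. *)
have [v vV vmin] := arg_minnP (fun v => #|colours V v|) v0V.
have {}vV : v \in V := vV.
set s := #|colours V v| in vmin; set r := cbrt16 s.
have m0 : 0 < mass V (V :\ v).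
  have /set0Pn[u uV] : V :\ v != set0.
    by rewrite -card_gt0; move: V1; rewrite (cardsD1 v V) vV add1n ltnS.
  rewrite /mass (bigD1 u) //=; apply: leq_trans (leq_addr _ _).
  exact: weight_gt0.
have [c cv pop] := mass_popular vV m0; rewrite -/s in pop.
have s0 : 0 < s by apply/card_gt0P; exists c.
have r0 : 0 < r by apply: cbrt16_gt0.
apply: contrapT => no.
pose reach M := M \subset V /\ {in M, forall v, c \in colours V v}.
(* If no set is deletable, each set reached within three steps has a neighbourhood more than [r]
   times as heavy. *)
have grow i M : i <= 3 -> linked i c M -> reach M -> 0 < mass V M ->
    r * mass V M < mass V (nbhd V c M).
  move=> i3 L [MV act] M0; rewrite ltnNge; apply/negP => le; apply: no; exists c, M.
  split=> //.
  - by apply: contraTneq M0 => ->; rewrite /mass big_set0.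
  - by move=> x y xM yM; apply: linked_indep L xM yM.
  - apply: leq_trans le _; rewrite /mass big_distrr /=; apply: leq_sum => u uM.
    by rewrite leq_mul2r cbrt16_homo ?orbT //; apply: vmin; apply: (subsetP MV).
have reach_succ b M : reach M -> reach (succ V b c M).
  move=> [MV _]; split; first by apply/subsetP => y; rewrite inE => /andP[].
  move=> y; rewrite inE => /andP[yV /exists_inP[x xM a]]; apply/coloursP.
  exists x; first exact: (subsetP MV).
  by rewrite adjacent_sym /adjacent; case: b a => ->; rewrite ?orbT.
have step i M : i <= 2 -> linked i c M -> reach M -> 0 < mass V M ->
    exists M', [/\ linked i.+1 c M', reach M', 0 < mass V M'
      & r * mass V M <= 2 * mass V M'].
  move=> i2 L RM M0; have gr := grow _ _ (leqW i2) L RM M0.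
  have [b hb] := mass_succ V c M; exists (succ V b c M).
  split; [exact: linked_succ | exact: reach_succ | lia | lia].
have R0 : reach [set v].
  by split=> [|u /set1P -> //]; rewrite sub1set.
have wv : mass V [set v] = wt V v by rewrite /mass big_set1.
have w0 : 0 < mass V [set v] by rewrite wv; apply: weight_gt0.
have g0 := grow 0 _ isT (@linked1 c v) R0 w0.
have [b hb] := mass_succ V c [set v].
have L1 := linked_succ (V := V) (b := b) (@linked1 c v).
have R1 := reach_succ b _ R0.
have M1 : 0 < mass V (succ V b c [set v]) by lia.
have [A2 [L2 R2 M2 h2]] := step 1 _ isT L1 R1 M1.
have [A3 [L3 R3 M3 h3]] := step 2 _ isT L2 R2 M2.
have g3 := grow 3 _ isT L3 R3 M3.
have tot : mass V V = mass V [set v] + mass V (V :\ v).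
  by rewrite /mass (big_setD1 v) //= big_set1.
have le1 : mass V (nbhd V c [set v]) <= mass V (V :\ v).
  apply: mass_subset; apply/subsetP => y; rewrite !inE => /andP[-> /exists_inP[x /set1P ->]].
  by rewrite andbT; apply: contraTneq => ->; rewrite adjacentxx.
have le3 : mass V (nbhd V c A3) <= mass V V.
  by apply: mass_subset; apply/subsetP => y; rewrite inE => /andP[].
(* By [g0] and [r >= 1], the vertex [v] weighs less than the rest of [V]. *)
have big : mass V V < 2 * mass V (V :\ v) by nia.
have r3 := cbrt16_ge s; rewrite -/r in r3.
move: (mass V V) (mass V (V :\ v)) (mass V (nbhd V c [set v]))
  (mass V (succ V b c [set v])) (mass V A2) (mass V A3)
  (mass V (nbhd V c A3)) big le3 g3 h3 h2 hb pop r3 s0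
  => W m m1 a1 a2 a3 a4 {no grow step} big le3 g3 h3 h2 hb pop r3 s0.
(* The contradiction is [r^3 a1 <= 4 r a3 < 4 W < 8 m <= 8 s m1 <= 16 s a1 <= r^3 a1]. The constant
   16 collects a factor 2 for each of three choices of sign and one from [W < 2 m]. *)
have e1 : 4 * (r * a3) >= r ^ 3 * a1.
  have : r * (r * (r * a1)) <= r * (r * (2 * a2)) by rewrite !leq_mul2l h2 !orbT.
  have : r * (2 * (r * a2)) <= r * (2 * (2 * a3)) by rewrite !leq_mul2l h3 !orbT.
  by lia.
have e2 : 16 * s * a1 <= r ^ 3 * a1 by rewrite leq_mul2r r3 orbT.
have e3 : s * m1 <= s * (2 * a1) by rewrite leq_mul2l hb orbT.
by lia.
Qed.

Lemma mass_le V : mass V V <= weight n 0.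
Proof.
have [k] := ubnP #|V|; elim: k V => // k IH V Vk.
have [V1|V1] := leqP #|V| 1; last first.
  have [c [M [MV M0 ind act le]]] := deletable V1.
  apply: leq_trans (mass_delete MV ind act le) (IH _ _).
  (* The induction advances because a point of [M] sees [c], so some vertex is deleted. *)
  suff lt : V :\: nbhd V c M \proper V.
    by have := proper_card lt; lia.
  have /set0Pn[x xM] := M0; have /coloursP[y yV a] := act _ xM.
  apply/properP; split; first exact: subsetDl.
  exists y => //; rewrite !inE yV andbT negbK; apply/exists_inP; by exists x.
have [->|/set0Pn[v vV]] := eqVneq V set0; first by rewrite /mass big_set0.
have -> : V = [set v] by apply/esym/eqP; rewrite eqEcard sub1set vV cards1.
by rewrite /mass big_set1; apply: weight_anti (card_colours _ _).
Qed.

Lemma length_bound : N < weight n 0.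
Proof.
rewrite -[N.+1]card_ord -cardsT -sum1_card; apply: leq_trans (mass_le setT).
by apply: leq_sum => v _; apply: weight_gt0.
Qed.
End Colouring.

(** * Comparison of the squared weight with a factorial *)

Lemma cbrt16_growth : exists n0, forall n, n0 <= n ->
  (cbrt16 (n + 4)).+1 ^ 8 <= (n - n %/ 4) ^ 3.
Proof.
have [K defK] : exists K, K = 64 ^ 3 by exists (64 ^ 3).
have K0 : 0 < K by rewrite defK expn_gt0.
pose B := K * 2 ^ 8.
have B1 : 1 < B by rewrite /B; lia.
(* With [cbrt16 (n + 4) = u.+1], this threshold gives [(B + 2) ^ 8 <= e], which settles [u < B]. For
   [u >= B], [K (2 u)^8 = B u^8 <= u^9 <= (64 e)^3 = K e^3]. *)
exists (4 + 2 * (B + 2) ^ 8) => n hn; set e := n - n %/ 4.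
have ne : n <= 2 * e by rewrite /e; lia.
set q := cbrt16 (n + 4); case defq : q => [|u].
  have : (B + 2) ^ 8 <= e by lia.
  have : 0 < (B + 2) ^ 8 by rewrite expn_gt0 addn_gt0 orbT.
  by move=> h1 h2; rewrite exp1n expn_gt0; lia.
have hu : u ^ 3 < 64 * e.
  have : u ^ 3 < 16 * (n + 4).
    by rewrite ltnNge; apply/negP => /cbrt16_min; rewrite -/q defq ltnn.
  by lia.
have [uB|Bu] := ltnP u B.
  apply: (@leq_trans e); last by rewrite -[leqLHS]expn1 leq_pexp2l //; lia.
  apply: (@leq_trans ((B + 2) ^ 8)); last by lia.
  by rewrite leq_exp2r //; lia.
apply: (@leq_trans ((2 * u) ^ 8)); first by rewrite leq_exp2r //; lia.
rewrite -(leq_pmul2l K0) expnMn mulnA -/B.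
apply: (@leq_trans (u * u ^ 8)); first by rewrite leq_mul2r Bu orbT.
rewrite -expnS defK -expnMn.
by rewrite (expnM u 3 3) leq_exp2r // ltnW.
Qed.

(** Induction in steps of 4: the squared weight gains at most [q ^ 8], of order [n^(8/3)], while the
    factorial gains three factors, of order [n^3]. The constant [C] absorbs the small cases. *)
Lemma weight_fact : exists C, forall n, weight n 0 ^ 2 <= C * (n - (n %/ 4).+1)`!.
Proof.
have [n0 growth] := cbrt16_growth.
pose C := \sum_(i < n0 + 5) weight i 0 ^ 2; exists C.
elim/ltn_ind => n IH; have [lt|ge] := ltnP n (n0 + 5).
  apply: (@leq_trans C); last by rewrite leq_pmulr // fact_gt0.
  by rewrite /C (bigD1 (Ordinal lt)) //= leq_addr.
have [m defn] : exists m, n = m + 4 by exists (n - 4); lia.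
have hm : n0 < m by lia.
set q := (cbrt16 (m + 4)).+1; set f := m - (m %/ 4).+1.
have step : weight n 0 <= weight m 0 * q ^ 4.
  rewrite /weight (@big_cat_nat _ _ _ m 0 n) //=; last by lia.
  rewrite leq_mul2l; apply/orP; right.
  apply: (@leq_trans (\prod_(m <= j < n) q)); last first.
    by rewrite prod_nat_const_nat defn addKn.
  rewrite big_nat_cond [leqRHS]big_nat_cond; apply: leq_prod => j /andP[/andP[_ jn] _].
  by rewrite ltnS cbrt16_homo // -defn.
have -> : n - (n %/ 4).+1 = f.+3 by rewrite /f; lia.
apply: (@leq_trans ((weight m 0 * q ^ 4) ^ 2)); first by rewrite leq_exp2r.
rewrite expnMn -expnM; apply: (@leq_trans (C * f`! * (m - m %/ 4) ^ 3)).
  by apply: leq_mul; [apply: IH; lia | apply/growth/ltnW].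
rewrite -mulnA leq_mul2l; apply/orP; right.
have -> : m - m %/ 4 = f.+1 by rewrite /f; lia.
rewrite !factS mulnC; set F := f`!.
rewrite [leqRHS](_ : _ = (f.+3 * f.+2 * f.+1) * F); last by ring.
by rewrite leq_mul2r; apply/orP; right; nia.
Qed.

(** * Logarithmic estimates and the final bound *)

Local Open Scope ring_scope.

(** From [exp (-1/6) >= 5/6] follows [e <= (6/5)^6 < 3]. This makes [ln (ln 3)] positive. *)
Lemma ln3_gt1 (R : realType) : 1 < ln (3 : R).
Proof.
rewrite -ltr_expR lnK ?posrE //.
have le : 5 / 6 <= expR (- 6^-1 : R).
  by apply: le_trans (expR_ge1Dx _); lra.
have e6 : expR (1 : R) = expR (6^-1) ^+ 6.
  by rewrite -expRM_natl; congr expR; lra.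
have p := expR_gt0 (6^-1 : R).
have up : expR (6^-1 : R) <= 6 / 5.
  have : expR (- 6^-1 : R) * expR (6^-1) = 1 by rewrite -expRD addNr expR0.
  by nra.
rewrite e6; apply: le_lt_trans (_ : (6 / 5) ^+ 6 < _); last by lra.
by rewrite lerXn2r ?nnegrE; lra.
Qed.

Theorem theorem5 (R : realType) :
  exists c C : R, [/\ 0 < c, 0 < C &
    forall n : nat, (3 <= n)%N ->
    exists k : nat,
      [/\ c * (ln n%:R / ln (ln n%:R)) <= k%:R,
          (k <= n)%N
        & forall (N : nat) (chi : nat -> 'I_n), (0 < N)%N ->
          ~ (exists (x : 'I_12 -> nat) (y : 'I_9 -> nat),
               monochromatic_solution N chi x y) ->
          N%:R <= C * Num.sqrt ((n - k)`!%:R)]].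
Proof.
have [C hC] := weight_fact; have l3 := ln3_gt1 R.
have ll3 : 0 < ln (ln (3 : R)) by apply: ln_gt0.
(* As [ln (ln n) >= ln (ln 3)], this [c] bounds the left side by [ln n / 4], which is below [n / 4].
   The successor in [C.+1] ensures positivity. *)
exists (ln (ln 3) / 4), (Num.sqrt (C.+1%:R)).
split; [by rewrite divr_gt0 | by rewrite sqrtr_gt0 | move=> n n3].
exists (n %/ 4).+1; split; [| by lia |].
  have n3R : 3 <= n%:R :> R by rewrite ler_nat.
  have lln : ln 3 <= ln (n%:R : R) by rewrite ler_ln ?posrE; lra.
  have llln : ln (ln 3) <= ln (ln (n%:R : R)) by rewrite ler_ln ?posrE; lra.
  apply: (@le_trans _ _ (ln n%:R / 4)).
    rewrite mulrA ler_pdivrMr; last by lra.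
    rewrite mulrAC [leRHS]mulrAC ler_pM2r ?invr_gt0 // mulrC.
    by rewrite ler_pM2l //; lra.
  have lnn : ln (n%:R : R) < n%:R by apply: ln_sublinear; lra.
  have : (n <= 4 * (n %/ 4).+1)%N by lia.
  by rewrite -(ler_nat R) natrM; lra.
move=> N chi _ nosol; have Nw := length_bound nosol.
rewrite -sqrtrM // -(ger0_norm (ler0n R N)) -sqrtr_sqr ler_wsqrtr //.
rewrite -natrX -natrM ler_nat; apply: (@leq_trans (weight n 0 ^ 2)).
  by rewrite leq_exp2r // ltnW.
by apply: leq_trans (hC n) _; rewrite leq_mul2r leqnSn orbT.
Qed.
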